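(* Let $G$ be a graph with vertex set $V$, and let $\mathcal{G}$ be the family of minimal generating sets of $G$. If $\mathcal{G}=\{L\}$ for a single set $L\subseteq V$, then $\operatorname{nim}(\mathrm{DNT}(G))=\operatorname{pty}(L^c)$, where $L^c=V\setminus L$.
   Context: Graphs are finite and simple with nonempty vertex set. A set $K\subseteq V$ of vertices is convex if it contains every vertex lying on any shortest path between two elements of $K$. The convex hull $[P]$ of $P\subseteq V$ is the smallest convex set containing $P$. A set $P\subseteq V$ is generating if $[P]=V$; a minimal generating set is a generating set that is minimal under inclusion. For a finite set $A$, $\operatorname{pty}(A):=|A| \bmod 2\in\{0,1\}$. The game $\mathrm{DNT}(G)$ (do not terminate): the positions are the sets $P\subseteq V$ (of jointly selected vertices) with $[V\setminus P]=V$; the starting position is $\emptyset$; the options of $P$ are the sets $P\cup\{v\}$ with $v\in V\setminus P$ and $[V\setminus(P\cup\{v\})]=V$. The nim-value of a position is defined recursively by $\operatorname{nim}(p)=\operatorname{mex}\{\operatorname{nim}(q): q\text{ an option of }p\}$, where $\operatorname{mex}(A)$ is the smallest nonnegative integer not in $A$; the nim-value of a game is that of its starting position. *)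

(* Defs.v *)
From mathcomp Require Import all_boot.
From mathcomp Require Import boolp.

Set Implicit Arguments.
Unset Strict Implicit.
Unset Printing Implicit Defensive.

(* A graph is a finType [T] with a symmetric irreflexive [e : rel T].         *)

Lemma mex_exists (A : seq nat) : exists n, n \notin A.
Proof.
exists (sumn A).+1; apply/negP => /(nth_index 0) E.
have: all (leq^~ (sumn A)) A.
  elim: A {E} => //= a A IH; rewrite leq_addr /=.
  by apply: sub_all IH => x /leq_trans; apply; rewrite leq_addl.
move=> /allP /(_ (sumn A).+1); rewrite ltnn => H.
have nA : (sumn A).+1 \notin A by apply/negP => /H.
by move: E; rewrite nth_default // leqNgt index_mem.
Qed.

Definition mex (A : seq nat) : nat := ex_minn (mex_exists A).

Section Graph.
Variables (T : finType) (e : rel T).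
Implicit Types (x y : T) (p q : seq T) (K P : {set T}).

(* The vertices of the path are [x :: p]. *)
Definition gpath x y p : bool :=
  [&& path e x p, last x p == y & uniq (x :: p)].

Definition shortest_path x y p : Prop :=
  gpath x y p /\ forall q, gpath x y q -> size p <= size q.

Definition convex K : Prop :=
  forall x y p, x \in K -> y \in K -> shortest_path x y p ->
  forall z, z \in x :: p -> z \in K.

Definition hull P : {set T} :=
  \bigcap_(K : {set T} | `[< convex K >] && (P \subset K)) K.

Lemma hull_convex P : convex (hull P).
Proof.
move=> x y p /bigcapP xP /bigcapP yP sp z zp.
apply/bigcapP => K KP; have /andP[/asboolP cK _] := KP.
exact: (cK x y p (xP K KP) (yP K KP) sp).
Qed.

Lemma sub_hull P : P \subset hull P.
Proof. by apply/bigcapsP => K /andP[]. Qed.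

Lemma hull_min P K : convex K -> P \subset K -> hull P \subset K.
Proof. by move=> cK PK; apply: bigcap_inf; rewrite PK andbT; apply/asboolP. Qed.

Definition generating P : bool := hull P == [set: T].

Definition min_generating_sets : {set {set T}} :=
  [set P | minset generating P].

Definition dnt_position P : bool := generating (~: P).

Definition dnt_options P : {set {set T}} :=
  [set v |: P | v in ~: P & dnt_position (v |: P)].

(* [n] bounds the number of remaining moves; see [dnt_nimE] for the resulting *)
(* recursion.                                                                 *)
Fixpoint dnt_nim_rec (n : nat) P : nat :=
  if n is m.+1 then mex [seq dnt_nim_rec m Q | Q <- enum (dnt_options P)]
  else 0.

Definition dnt_nim P : nat := dnt_nim_rec #|~: P| P.

Lemma dnt_nimE P : dnt_nim P = mex [seq dnt_nim Q | Q <- enum (dnt_options P)].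
Proof.
rewrite {1}/dnt_nim; case E: #|~: P| => [|m] /=.
  have -> : dnt_options P = set0.
    apply/setP => Q; rewrite in_set0; apply/imsetP => -[v].
    by rewrite (cards0_eq E) !inE.
  by rewrite enum_set0 /mex /=; case: ex_minnP => k _ /(_ 0 isT); case: k.
congr mex; apply/eq_in_map => Q; rewrite mem_enum => /imsetP[v].
rewrite inE => /andP[vP _] ->; rewrite /dnt_nim; congr dnt_nim_rec.
apply/eqP; rewrite -eqSS -E (cardsD1 v (~: P)) vP add1n eqSS; apply/eqP.
by apply: eq_card => w; rewrite !inE negb_or.
Qed.

Definition nim_DNT : nat := dnt_nim set0.

End Graph.

Definition pty (T : finType) (A : {set T}) : nat := #|A| %% 2.

(* Main.v *)
Require Import Defs.
From mathcomp Require Import all_boot.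

(* If L is the only minimal generating set, the generating sets are exactly   *)
(* the supersets of L, so the positions are exactly the subsets of the        *)
(* complement of L.  Every maximal play from P thus uses up all the vertices  *)
(* outside L and P, and the nim-value is the parity of their number.          *)

(** Uniqueness of [L] turns the game into counting ([generating_unique]). Each move uses up exactly
    one available vertex, so by induction all options of a position share one value in {0,1}, and
    mex flips it ([dnt_nim_unique]). *)

Lemma mexP (A : seq nat) n :
  n \notin A -> (forall k, k < n -> k \in A) -> mex A = n.
Proof.
move=> nA ltA; rewrite /mex; case: ex_minnP => m mA min_m.
apply/eqP; rewrite eqn_leq min_m // leqNgt.
by apply: contra mA => /ltA.
Qed.

(** mex {0} = 1 and mex {1} = 0; nonemptiness matters for [b = false], as mex of the empty set is
    0. *)
Lemma mex_constant_bool (A : seq nat) (b : bool) :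
  A != [::] -> {in A, forall k, k = nat_of_bool b} -> mex A = ~~ b.
Proof.
move=> A0 Ab; apply: mexP => [|k lt_k].
  by apply/negP => /Ab; case: b {Ab}.
case: A A0 Ab => // a A _ Ab; rewrite inE (Ab a) ?mem_head //.
by case: b k lt_k {Ab} => [] [|[]].
Qed.

Lemma generatingS {T : finType} {e : rel T} {P Q : {set T}} :
  P \subset Q -> generating e P -> generating e Q.
Proof.
move=> PQ /eqP genP; rewrite /generating -subTset -genP.
by apply: hull_min (subset_trans PQ (sub_hull e Q)); apply: hull_convex.
Qed.

Section UniqueMinimalGeneratingSet.
Variables (T : finType) (e : rel T) (L : {set T}).
Implicit Type P : {set T}.
Hypothesis uniqL : min_generating_sets e = [set L].

(** By finiteness a generating set contains a minimal one, necessarily [L]; conversely, generation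
    passes to supersets. *)
Lemma generating_unique P : generating e P = (L \subset P).
Proof.
apply/idP/idP => [/minset_exists[M minM MP]|LP].
  have : M \in min_generating_sets e by rewrite inE.
  by rewrite uniqL => /set1P <-.
have : L \in min_generating_sets e by rewrite uniqL set11.
by rewrite inE => /minsetp; apply: generatingS.
Qed.

Lemma dnt_position_unique P : dnt_position e P = (P \subset ~: L).
Proof. by rewrite /dnt_position generating_unique subsetC. Qed.

Lemma dnt_nim_unique P : P \subset ~: L -> dnt_nim e P = odd #|~: L :\: P|.
Proof.
move: {2}#|_| (erefl #|~: L :\: P|) => n.
elim: n P => [|n IHn] P cardP PL; rewrite dnt_nimE cardP.
  (* No move remains: a legal [v] would lie in the empty set [~: L :\: P]. *)
  apply: mexP => //; apply/negP => /mapP[Q]; rewrite mem_enum.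
  case/imsetP => v; rewrite inE dnt_position_unique subUset sub1set.
  move=> /andP[vP /andP[vL _]] _ _.
  by move: (in_set0 v); rewrite -(cards0_eq cardP) inE vL -in_setC vP.
apply: mex_constant_bool.
  have /set0Pn[v] : ~: L :\: P != set0 by rewrite -card_gt0 cardP.
  rewrite inE => /andP[vP vL]; rewrite -size_eq0 size_map -cardE.
  rewrite -lt0n card_gt0; apply/set0Pn; exists (v |: P).
  apply: imset_f.
  by rewrite inE in_setC vP dnt_position_unique subUset sub1set vL.
move=> _ /mapP[_ /[!mem_enum] /imsetP[v /setIdP[vP posv] ->] ->].
move: posv; rewrite dnt_position_unique => vPL.
have cardvP : #|~: L :\: (v |: P)| = n.
  have vD : v \in ~: L :\: P.
    by rewrite inE -in_setC vP (subsetP vPL) // setU11.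
  by move: cardP; rewrite (cardsD1 v) vD setDDl setUC => -[].
by rewrite IHn // cardvP.
Qed.

End UniqueMinimalGeneratingSet.

Theorem proposition4p3 (T : finType) (e : rel T)
  (e_sym : symmetric e) (e_irr : irreflexive e) (T_nonempty : 0 < #|T|)
  (L : {set T}) (uniqL : min_generating_sets e = [set L]) :
  nim_DNT e = pty (~: L).
Proof.
by rewrite /nim_DNT (dnt_nim_unique _ _ _ uniqL) ?sub0set // setD0 /pty modn2.
Qed.
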